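(* Let $n$ be a positive integer, $j$ an integer with $0\le j\le n$, and $m$ a positive integer with $m\ge 2n$. Let $Schr(n,m,j,2)$ denote the number of lattice paths in the plane from $(0,0)$ to $(n,m)$, using steps $(1,0)$, $(0,1)$ and $(1,1)$, that never go below the line $y=2x$ (i.e. every lattice point $(x,y)$ on the path satisfies $y\ge 2x$) and that use exactly $j$ steps of the form $(1,0)$. Then \[ Schr(n,m,j,2)=\frac{m-2n+1}{n}\binom{n}{j}\binom{m+j}{n-1}. \] *)

(* Defs.v *)
From HB Require Import structures.
From mathcomp Require Import all_boot all_order all_algebra.

Set Implicit Arguments.
Unset Strict Implicit.
Unset Printing Implicit Defensive.

Inductive step := East | North | Diag.

Definition step_to_opt (s : step) : option bool :=
  match s with East => Some true | North => Some false | Diag => None end.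

Definition opt_to_step (o : option bool) : step :=
  match o with Some true => East | Some false => North | None => Diag end.

Lemma step_to_optK : cancel step_to_opt opt_to_step.
Proof. by case. Qed.

HB.instance Definition _ := Finite.copy step (can_type step_to_optK).

(* All three steps are nonnegative, so a path from the origin stays in the
   first quadrant and its points can be taken in nat * nat. *)
Definition move (P : nat * nat) (s : step) : nat * nat :=
  match s with
  | East => (P.1.+1, P.2)
  | North => (P.1, P.2.+1)
  | Diag => (P.1.+1, P.2.+1)
  end.

Definition path_points (p : seq step) : seq (nat * nat) :=
  (0, 0) :: scanl move (0, 0) p.

Definition path_end (p : seq step) : nat * nat := foldl move (0, 0) p.

Definition weakly_above (mu : nat) (p : seq step) : bool :=
  all (fun P : nat * nat => mu * P.1 <= P.2) (path_points p).

Definition is_schr_path (n m j mu : nat) (p : seq step) : bool :=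
  [&& path_end p == (n, m), weakly_above mu p & count_mem East p == j].

(* Paths are unrestricted sequences of steps; the length bound below only
   makes the ambient type finite and excludes no path. *)
Lemma is_schr_path_size n m j mu p :
  is_schr_path n m j mu p -> size p <= n + m.
Proof.
case/and3P=> /eqP end_p _ _.
have len q P : P.1 + P.2 + size q <= (foldl move P q).1 + (foldl move P q).2.
  elim: q P => [|s q IHq] P /=; first by rewrite addn0.
  apply: leq_trans (IHq _); rewrite addnS -addSn leq_add2r.
  by case: s => /=; rewrite ?addSn ?addnS // ltnW.
by have := len p (0, 0); rewrite -/(path_end p) end_p.
Qed.

Definition Schr (n m j mu : nat) : nat :=
  #|[set p : (n + m).-bseq step | is_schr_path n m j mu p]|.

(* Main.v *)
(* Classifying the paths by their last step gives
     F(n,m,j) = F(n-1,m,j-1) + F(n,m-1,j) + F(n-1,m-1,j)   for m >= 2n >= 2,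
   where the terms ending below the line vanish.  The closed form satisfies the
   same recurrence, and it too vanishes at m = 2n-1, the only position below the
   line that the recurrence reaches. *)
Require Import Defs.
From mathcomp Require Import all_boot all_order all_algebra.
From mathcomp Require Import ring zify.

Import GRing.Theory.
Local Open Scope ring_scope.

Section CountBoundedSequences.
Local Open Scope nat_scope.
Variables (T : finType) (N : nat) (P : pred (seq T)).
Hypothesis size_P : forall p, P p -> size p <= N.

Definition bseq_list : seq (seq T) :=
  [seq val p | p <- enum [set p : N.-bseq T | P p]].

Lemma bseq_list_uniq : uniq bseq_list.
Proof. by rewrite map_inj_uniq ?enum_uniq //; apply: val_inj. Qed.

Lemma mem_bseq_list p : (p \in bseq_list) = P p.
Proof.
apply/mapP/idP => [[q]|Pp]; first by rewrite mem_enum inE => Pq ->.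
by exists (Bseq (size_P _ Pp)); rewrite // mem_enum inE.
Qed.

(** The terms of the recurrence live in bounded-sequence types with different bounds. Counting
    through any duplicate-free list of plain sequences lets them be compared. *)
Lemma card_bseq_list (s : seq (seq T)) :
  uniq s -> s =i P -> #|[set p : N.-bseq T | P p]| = size s.
Proof.
move=> s_uniq mem_s; rewrite cardE -(size_map val); apply: perm_size.
apply: uniq_perm => // [|p]; first exact: bseq_list_uniq.
by rewrite mem_s; apply: mem_bseq_list.
Qed.

End CountBoundedSequences.

Section SchroderRecurrence.
Local Open Scope nat_scope.
Variable mu : nat.

Lemma path_end_rcons p s : path_end (rcons p s) = move (path_end p) s.
Proof. by rewrite /path_end foldl_rcons. Qed.

Lemma weakly_above_rcons p s :
  weakly_above mu (rcons p s) =
  weakly_above mu p && (mu * (path_end (rcons p s)).1 <= (path_end (rcons p s)).2).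
Proof.
rewrite /weakly_above /path_points /path_end /= -!andbA; congr (_ && _).
elim: p (0, 0) => [|t p IHp] Q /=; first by rewrite andbT.
by rewrite IHp andbA.
Qed.

Lemma is_schr_path_end n m j p :
  is_schr_path n m j mu p -> mu * n <= m.
Proof.
case/and3P=> /eqP; case/lastP: p => [|p s].
  by case=> <- <-; rewrite muln0.
by move=> end_p; rewrite weakly_above_rcons end_p => /andP[].
Qed.

(** The points of [p] are constrained by [p] itself, so the last step adds only the condition on the
    new endpoint. The positivity guards rule out truncated predecessors at 0. *)
Lemma is_schr_path_rcons n m j p s :
  is_schr_path n m j mu (rcons p s) =
  (mu * n <= m) &&
  match s with
  | East => [&& 0 < n, 0 < j & is_schr_path n.-1 m j.-1 mu p]
  | North => (0 < m) && is_schr_path n m.-1 j mu p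
  | Diag => [&& 0 < n, 0 < m & is_schr_path n.-1 m.-1 j mu p]
  end.
Proof.
rewrite /is_schr_path weakly_above_rcons path_end_rcons -cats1 count_cat /=.
case: (path_end p) => x y.
case: s; rewrite ?addn0 ?addn1 /=; case: n => [|n]; case: m => [|m];
  try case: j => [|j]; rewrite ?xpair_eqE ?eqSS //= ?andbF //;
  case: (x =P _) => [->|_]; case: (y =P _) => [->|_] //=; rewrite ?andbF //;
  by case: (weakly_above _ _); case: (_ <= _); rewrite ?andbF.
Qed.

Definition schr_paths n m j := bseq_list step (n + m) (is_schr_path n m j mu).

Lemma schr_paths_uniq n m j : uniq (schr_paths n m j).
Proof. exact: bseq_list_uniq. Qed.

Lemma mem_schr_paths n m j p : (p \in schr_paths n m j) = is_schr_path n m j mu p.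
Proof. exact/mem_bseq_list/is_schr_path_size. Qed.

Lemma Schr_size n m j (s : seq (seq step)) :
  uniq s -> s =i is_schr_path n m j mu -> Schr n m j mu = size s.
Proof. exact/card_bseq_list/is_schr_path_size. Qed.

Lemma size_schr_paths n m j : size (schr_paths n m j) = Schr n m j mu.
Proof.
by rewrite -(@Schr_size n m j) ?schr_paths_uniq // => p; apply: mem_schr_paths.
Qed.

Lemma Schr_below n m j : m < mu * n -> Schr n m j mu = 0.
Proof.
move=> lt_m; rewrite (@Schr_size _ _ _ [::]) // => p.
by apply/esym/negP => /is_schr_path_end; rewrite leqNgt lt_m.
Qed.

(** [East] and [Diag] both raise the abscissa, so width 0 leaves only [North] steps. *)
Lemma is_schr_path_0l m j p :
  is_schr_path 0 m j mu p = (j == 0) && (p == nseq m North).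
Proof.
elim/last_ind: p m => [|p s IHp] m.
  rewrite /is_schr_path /weakly_above /= muln0 eq_sym.
  by case: j m => [|j] [|m].
have nseqR k : nseq k.+1 North = rcons (nseq k North) North.
  by rewrite -cats1 -addn1 nseqD.
rewrite is_schr_path_rcons muln0 leq0n /=.
have rcons_nil t : (rcons p t == [::]) = false by case: (p).
case: m => [|m]; rewrite ?rcons_nil ?nseqR ?eqseq_rcons ?andbF.
  by case: s.
by case: s; rewrite ?andbF // andbT IHp.
Qed.

Lemma Schr_0l m j : Schr 0 m j mu = (j == 0).
Proof.
(* The boolean [j == 0] is read as a number: the list holds the vertical path once if [j = 0] and is
   empty otherwise. *)
rewrite (@Schr_size _ _ _ (nseq (j == 0) (nseq m North))) ?size_nseq //.
  by case: eqP.
by move=> p; rewrite -[RHS]topredE /= is_schr_path_0l; case: eqP; rewrite ?inE.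
Qed.

Lemma mem_map_rcons (L : seq (seq step)) (p : seq step) s t :
  (rcons p s \in [seq rcons q t | q <- L]) = (s == t) && (p \in L).
Proof.
apply/mapP/andP => [[q Lq /rcons_inj[-> ->]]|[/eqP -> Lp]] //.
by exists p.
Qed.

Lemma SchrS n m j :
  mu * n.+1 <= m.+1 ->
  Schr n.+1 m.+1 j mu =
    (if j is j'.+1 then Schr n m.+1 j' mu else 0) +
    Schr n.+1 m j mu + Schr n m j mu.
Proof.
move=> above; pose ends s := map (rcons^~ s : seq step -> seq step).
pose LE := if j is j'.+1 then schr_paths n m.+1 j' else [::].
(* Each block is duplicate-free because [rcons] is injective, and the blocks are disjoint because
   their last steps differ. The empty path does not reach this endpoint. *)
rewrite (@Schr_size _ _ _ (ends East LE ++ ends North (schr_paths n.+1 m j)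
                           ++ ends Diag (schr_paths n m j))).
- have size_ends s L : size (ends s L) = size L by rewrite size_map.
  rewrite !size_cat !size_ends !size_schr_paths addnA; congr (_ + _ + _).
  by rewrite /LE; case: (j) => // j'; rewrite size_schr_paths.
- have ends_uniq s L : uniq L -> uniq (ends s L).
    by move=> uL; rewrite map_inj_uniq // => p q /rcons_inj[].
  rewrite !cat_uniq !ends_uniq ?schr_paths_uniq //=; last first.
    by rewrite /LE; case: (j) => // j'; apply: schr_paths_uniq.
  rewrite andbT; apply/andP; split; apply/hasPn => p.
    by rewrite mem_cat => /orP[] /mapP[q _ ->]; rewrite mem_map_rcons.
  by case/mapP=> q _ ->; rewrite mem_map_rcons.
- move=> p; rewrite !mem_cat -[RHS]topredE /=; case/lastP: p => [|p s].
    have nil_ends s L : ([::] \in ends s L) = false.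
      by apply/negP => /mapP[[|? ?]].
    by rewrite !nil_ends.
  rewrite !mem_map_rcons !mem_schr_paths is_schr_path_rcons above /=.
  case: s => //=; rewrite ?orbF //.
  by rewrite /LE; case: (j) => //= j'; rewrite mem_schr_paths.
Qed.

End SchroderRecurrence.

Section NaturalBinomialsInRing.
Variable R : nzRingType.

(** For [k > n] the difference in the ring is negative instead of truncated, but it multiplies a
    zero binomial. *)
Lemma natr_bin_left (n k : nat) :
  k.+1%:R * 'C(n, k.+1)%:R = (n%:R - k%:R) * 'C(n, k)%:R :> R.
Proof.
rewrite -natrM mul_bin_left; have [le_kn|lt_nk] := leqP k n.
  by rewrite natrM natrB.
by rewrite bin_small // muln0 mulr0.
Qed.

Lemma natr_bin_down (n k : nat) :
  n.+1%:R * 'C(n, k)%:R = (n.+1%:R - k%:R) * 'C(n.+1, k)%:R :> R.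
Proof.
rewrite -natrM mul_bin_down; have [le_kn|lt_nk] := leqP k n.+1.
  by rewrite natrM natrB.
by rewrite bin_small // muln0 mulr0.
Qed.

End NaturalBinomialsInRing.

(** The range starts one unit below the line, so that the [North] term at a point on the line is
    covered by the induction on [m]. Clearing the denominator keeps the statement free of
    division. *)
Lemma Schr2_formula (n m j : nat) : (2 * n.+1 <= m.+1)%N ->
  n.+1%:R * (Schr n.+1 m j 2)%:R =
    (m%:R - 2 * n.+1%:R + 1) * ('C(n.+1, j))%:R * ('C(m + j, n))%:R :> rat.
Proof.
elim: n m j => [|n IHn] m j; elim: m j => [//|m IHm] j.
- rewrite leq_eqVlt => /orP[/eqP def_m|lt_m].
    rewrite Schr_below; last by rewrite ltnS in def_m *; lia.
    have ->: m = 0%N by lia.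
    by rewrite mulr0; ring.
  rewrite SchrS; last by lia.
  have:= IHm j; rewrite !bin0 !mul1r !mulr1 !natrD => -> ; last by lia.
  rewrite Schr_0l -(@natr1 _ m).
  (* The width-0 terms contribute 1 through [Diag] when [j = 0] and 1 through [East] when [j = 1],
     which matches ['C(1, j)]. *)
  case: j => [|[|j]]; rewrite ?Schr_0l ?bin0 ?bin1 ?bin_small //=; ring.
- rewrite leq_eqVlt => /orP[/eqP def_m|lt_m].
    rewrite Schr_below; last by lia.
    have -> : m = (2 * n + 2)%N by lia.
    by rewrite mulr0 -!natr1 natrD natrM; ring.
  rewrite SchrS; last by lia.
  have nz k : k.+1%:R != 0 :> rat by rewrite Num.Theory.pnatr_eq0.
  have nz1 := nz n; have nz2 := nz n.+1.
  have F2 := IHm j ltac:(lia); have F3 := IHn m j ltac:(lia).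
  (* These relations make every term a rational multiple of ['C(n.+2, j) * 'C(m + j, n)], which
     reduces the recurrence to an identity of rational functions. *)
  have bin_e := natr_bin_down rat n.+1 j.
  have bin_B := natr_bin_left rat (m + j) n.
  rewrite addSn binS !natrD.
  move/(canRL (mulKf nz2)): F2 => ->; move/(canRL (mulKf nz1)): F3 => ->.
  move/(canRL (mulKf nz2)): bin_e => ->; move/(canRL (mulKf nz1)): bin_B => ->.
  case: j {IHm} => [|j].
    rewrite addn0 -!natr1 in nz1 nz2 *; field; by rewrite ?nz1 ?nz2.
  have F1 := IHn m.+1 j ltac:(lia).
  (* The [East] term carries ['C(n.+1, j)], with [j] one less than in the goal; absorption turns it
     into a multiple of ['C(n.+2, j.+1)]. *)
  have bin_d := mul_bin_diag n.+2 j.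
  move/(congr1 (fun k => k%:R : rat)): bin_d; rewrite !natrM /= => bin_d.
  move/(canRL (mulKf nz1)): F1 => ->; move/(canRL (mulKf nz2)): bin_d => ->.
  rewrite addSnnS natrD -!natr1 in nz1 nz2 *; field; by rewrite ?nz1 ?nz2.
Qed.

Theorem theorem5 (n j m : nat) (hn : (0 < n)%N) (hj : (j <= n)%N)
    (hm : (0 < m)%N) (hmn : (2 * n <= m)%N) :
  (Schr n m j 2)%:R =
    (m%:R - 2 * n%:R + 1) / n%:R * ('C(n, j))%:R * ('C(m + j, n - 1))%:R :> rat.
Proof.
case: n hn hj hmn => // n _ _ hmn; rewrite subn1 /=.
have n_neq0 : n.+1%:R != 0 :> rat by rewrite Num.Theory.pnatr_eq0.
apply: (mulfI n_neq0); rewrite Schr2_formula; last exact: leqW.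
by field; rewrite addrC natr1.
Qed.
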